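(* Assume that the family $(\widetilde{\Lambda}_n)$, $\widetilde{\Lambda}_n=\{e^{i\nu_{n,k}}:k=1,\dots,L_n\}\subseteq\mathbb{T}$ (the $L_n$ points being pairwise distinct), is a Marcinkiewicz-Zygmund family for $\mathcal{P}_n$ on the torus, i.e., there are constants $A,B>0$ independent of $n$ such that for all sufficiently large $n$ $$A\|p\|_{L^2(\mathbb{T})}^2\le\sum_{k=1}^{L_n}\frac{|p(e^{i\nu_{n,k}})|^2}{n}\le B\|p\|_{L^2(\mathbb{T})}^2\qquad\text{for all } p\in\mathcal{P}_n .$$ Fix $\gamma>0$ arbitrary, for every $n>\gamma$ and $k=1,\dots,L_n$ choose $\rho_{n,k}\in[1-\frac{\gamma}{n},1)$ arbitrary, and set $\Lambda_n=\{\rho_{n,k}e^{i\nu_{n,k}}:k=1,\dots,L_n\}$. Then $(\Lambda_n)$ is a Marcinkiewicz-Zygmund family for $\mathcal{P}_n$ in $H^2(\mathbb{D})$.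
   Context: $\mathbb{D}$ is the open unit disk in $\mathbb{C}$ and $\mathbb{T}=\partial\mathbb{D}$. $\mathcal{P}_n$ is the space of polynomials in $z$ of degree at most $n$. $\|f\|_{L^2(\mathbb{T})}^2=\int_0^1|f(e^{2\pi it})|^2\,dt$. The Hardy space $H^2(\mathbb{D})$ consists of the analytic functions on $\mathbb{D}$ whose boundary values on $\mathbb{T}$ lie in $L^2(\mathbb{T})$, with norm $\|f\|_{H^2}=\|f\|_{L^2(\mathbb{T})}$ (equivalently $\|\sum_j a_jz^j\|_{H^2}^2=\sum_j|a_j|^2$). The reproducing kernel of $\mathcal{P}_n$ in $H^2(\mathbb{D})$ is $k_n(z,w)=\sum_{j=0}^n(z\bar w)^j$. A sequence of finite sets $\Lambda_n$ is a Marcinkiewicz-Zygmund family for $\mathcal{P}_n$ in $H^2(\mathbb{D})$ if there are constants $A',B'>0$ (independent of $n$) and $n_0$ such that for all $n\ge n_0$ and all $p\in\mathcal{P}_n$, $A'\|p\|_{H^2}^2\le\sum_{\lambda\in\Lambda_n}\frac{|p(\lambda)|^2}{k_n(\lambda,\lambda)}\le B'\|p\|_{H^2}^2$. *)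

(* Defs.v *)
From mathcomp Require Export all_boot all_order all_algebra.
From mathcomp Require Export finmap complex.
From mathcomp Require Export all_classical all_reals all_analysis.

Set Implicit Arguments.
Unset Strict Implicit.
Unset Printing Implicit Defensive.

Import Order.TTheory GRing.Theory Num.Theory.
Import ComplexField.Normc.

Local Open Scope classical_set_scope.
Local Open Scope ring_scope.

Definition expi (R : realType) (theta : R) : R[i] := (cos theta +i* sin theta)%C.

(* [normc] is the complex modulus as an element of [R]. *)
Definition normL2T (R : realType) (f : R[i] -> R[i]) : R :=
  Num.sqrt (\int[lebesgue_measure]_(t in `[0%R, 1%R])
    (normc (f (expi (2 * pi * t))) ^+ 2)).

(* Polynomials extend continuously to the closed disk, so their boundary values
   are their restrictions to the circle. *)
Definition normH2 (R : realType) (p : {poly R[i]}) : R := normL2T (horner p).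

(* [size p] is the degree plus one, and [size 0 = 0]. *)
Definition inPn (R : realType) (n : nat) (p : {poly R[i]}) : Prop :=
  (size p <= n.+1)%N.

Definition kern (R : realType) (n : nat) (z w : R[i]) : R[i] :=
  \sum_(0 <= j < n.+1) (z * w^*) ^+ j.

Definition MZ_torus (R : realType) (L : nat -> nat)
    (nu : forall n, 'I_(L n) -> R) : Prop :=
  exists A B : R, [/\ 0 < A, 0 < B &
    exists n0 : nat, forall n, (n0 <= n)%N -> forall p : {poly R[i]}, inPn n p ->
      let S := \sum_(k < L n)
                 normc p.[expi (nu n k)] ^+ 2 / n%:R in
      A * normL2T (horner p) ^+ 2 <= S /\ S <= B * normL2T (horner p) ^+ 2].

(* The diagonal value [kern n l l] is real, so [complex.Re] is only a cast. *)
Definition MZ_H2 (R : realType) (Lam : nat -> {fset R[i]}) : Prop :=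
  exists A B : R, [/\ 0 < A, 0 < B &
    exists n0 : nat, forall n, (n0 <= n)%N -> forall p : {poly R[i]}, inPn n p ->
      let S := \sum_(l <- Lam n)
                 normc p.[l] ^+ 2 / complex.Re (kern n l l) in
      A * normH2 p ^+ 2 <= S /\ S <= B * normH2 p ^+ 2].

(* Main.v *)
Require Import Defs.
From mathcomp Require Import ring lra.

Import Order.TTheory GRing.Theory Num.Theory numFieldNormedType.Exports.
Import ComplexField.Normc.
Local Open Scope fset_scope.
Local Open Scope ring_scope.

Set Implicit Arguments.
Unset Strict Implicit.

(** Moving the sampling points radially by up to gamma / n is too large a
perturbation for a Bernstein-type estimate, which would need gamma small with
respect to A. Instead the perturbation is absorbed into the polynomial, by
moving its zeros.

Put r = 1 - gamma / n. For a polynomial p of degree at most n there is another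
one, q, such that for every rho in [r, 1] and every z on the circle,
  r^n |q(z)| <= |p(rho z)|   and   r^n |p(z)| <= |q(r z)|.
Both properties are multiplicative, so it suffices to treat one linear factor
X - w. If |w| >= 1, it is kept. If |w| < 1, the zero is first pushed radially
outwards to a point u of the closed disk with r |z - u| <= |rho z - w|, and then
reflected in the unit circle, which changes no modulus on the circle but keeps
the new factor large on the circle of radius r (lemma [factor_minorant]). The
sampling inequality on the torus applied to q bounds the sum for p from below by
a multiple of the norm of q. By Parseval the norm of q dominates that of q(r .),
which by the second property dominates r^n times that of p.

The upper bound has the same shape with a simpler replacement: reflecting in
the circle the zeros of p inside the disk gives h with |h| = |p| on the circle
and |h| >= |p| in the disk, and a polynomial without zeros in the open disk
loses at most a factor r^n when its argument is contracted within the annulus.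
So q = h(r .) satisfies r^n |p(rho z)| <= |q(z)| while its norm is at most that
of p (lemmas [factor_majorant], [sampling_majorant]).

Finally r^n >= exp(-2 gamma) once n >= 2 gamma, so all constants are uniform in
n; this also makes the kernel k_n comparable to n at the moved points. *)

(** * Modulus inequalities for one zero *)

Lemma normc_sqr (R : realType) (z : R[i]) :
  normc z ^+ 2 = complex.Re z ^+ 2 + complex.Im z ^+ 2.
Proof. by case: z => x y /=; rewrite sqr_sqrtr ?addr_ge0 ?sqr_ge0. Qed.

Lemma normc_ge0 (R : realType) (z : R[i]) : 0 <= normc z.
Proof. by case: z => x y; apply: sqrtr_ge0. Qed.

Lemma normc_real (R : realType) (t : R) : 0 <= t -> normc t%:C%C = t.
Proof. by move=> t0; rewrite /= expr0n /= addr0 sqrtr_sqr ger0_norm. Qed.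

Lemma normc_subC (R : realType) (z w : R[i]) : normc (z - w) = normc (w - z).
Proof. by rewrite -(normcN (z - w)) opprB. Qed.

Lemma ler_normc_sqr (R : realType) (z w : R[i]) :
  (normc z ^+ 2 <= normc w ^+ 2) = (normc z <= normc w).
Proof. by rewrite ler_pXn2r ?nnegrE ?normc_ge0. Qed.

Lemma normc_expi (R : realType) (theta : R) : normc (expi theta) = 1.
Proof. by rewrite /= cos2Dsin2 sqrtr1. Qed.

Lemma normc_scale (R : realType) (t : R) (z : R[i]) :
  0 <= t -> normc (t%:C%C * z) = t * normc z.
Proof. by move=> t0; rewrite normcM normc_real. Qed.

(** The difference of the squares is [1 - t] times a sum of terms that are
nonnegative for [|z| <= |w|]. *)
Lemma normc_sub_shrink (R : realType) (t : R) (z w : R[i]) :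
  0 <= t <= 1 -> normc z <= normc w ->
  t * normc (z - w) <= normc (t%:C%C * z - w).
Proof.
move=> /andP[t0 t1]; rewrite -normc_scale // -!ler_normc_sqr !normc_sqr.
case: z => a b; case: w => c d /= zw.
rewrite -subr_ge0 (_ : _ - _ = (1 - t) * ((1 - t) * (c ^+ 2 + d ^+ 2) +
  t * (c ^+ 2 + d ^+ 2 - (a ^+ 2 + b ^+ 2)) +
  t * ((a - c) ^+ 2 + (b - d) ^+ 2))); last by ring.
apply: mulr_ge0; first by rewrite subr_ge0.
by do !apply: addr_ge0; apply: mulr_ge0; rewrite ?subr_ge0 ?addr_ge0 ?sqr_ge0.
Qed.

(** The Blaschke factor identity. The zero of [1 - conj w z] is the reflection
of [w] in the circle, so replacing [z - w] by it keeps the modulus on the circle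
and, for [w] in the disk, does not decrease it inside. *)
Lemma normc_reflect (R : realType) (z w : R[i]) :
  normc (1 - conjc w * z) ^+ 2 =
  normc (z - w) ^+ 2 + (1 - normc z ^+ 2) * (1 - normc w ^+ 2).
Proof. by rewrite !normc_sqr; case: z => a b; case: w => c d /=; ring. Qed.

Lemma normc_reflect_circle (R : realType) (z w : R[i]) : normc z = 1 ->
  normc (1 - conjc w * z) = normc (z - w).
Proof.
move=> z1; apply/eqP; rewrite -(eqrXn2 (n := 2)) ?normc_ge0 //.
by rewrite normc_reflect z1 expr1n subrr mul0r addr0.
Qed.

Lemma le_normc_reflect (R : realType) (z w : R[i]) :
  normc z <= 1 -> normc w <= 1 -> normc (z - w) <= normc (1 - conjc w * z).
Proof.
move=> z1 w1; rewrite -ler_normc_sqr normc_reflect lerDl mulr_ge0 // subr_ge0.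
all: by rewrite expr_le1 ?normc_ge0.
Qed.

(** This lets zeros close to the circle be projected onto it. It holds because
[|s z - t w|^2 = (s - t)^2 + s t |z - w|^2] for unimodular [z] and [w]. *)
Lemma normc_sub_radial (R : realType) (r s t : R) (z w : R[i]) :
  0 <= r -> r <= s -> r <= t -> normc z = 1 -> normc w = 1 ->
  r * normc (z - w) <= normc (s%:C%C * z - t%:C%C * w).
Proof.
move=> r0 rs rt z1 w1; rewrite -normc_scale // -ler_normc_sqr.
have := normc_sqr z; have := normc_sqr w; rewrite z1 w1 !normc_sqr expr1n.
case: z {z1} => a b; case: w {w1} => c d /= W Z.
have rst : 0 <= s * t - r ^+ 2.
  by rewrite subr_ge0 expr2 ler_pM.
rewrite -subr_ge0 (_ : _ - _ = (s - t) ^+ 2 +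
  (s * t - r ^+ 2) * ((a - c) ^+ 2 + (b - d) ^+ 2) +
  (s ^+ 2 - s * t) * (a ^+ 2 + b ^+ 2 - 1) +
  (t ^+ 2 - s * t) * (c ^+ 2 + d ^+ 2 - 1)); last by ring.
rewrite -W -Z !subrr !mulr0 !addr0.
by apply: addr_ge0; [exact: sqr_ge0 | rewrite mulr_ge0 // addr_ge0 ?sqr_ge0].
Qed.

(** A point of the circle only gets farther from the closed disk when it is
pushed outwards; everything is scaled here by [r]. *)
Lemma le_normc_sub_dilate (R : realType) (r s : R) (z u : R[i]) :
  0 <= r -> r <= s -> normc z = 1 -> normc u <= 1 ->
  r * normc (z - u) <= normc (s%:C%C * z - r%:C%C * u).
Proof.
move=> r0 rs z1 u1; rewrite -normc_scale // -ler_normc_sqr.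
have := normc_sqr z; have : normc u ^+ 2 <= 1 by rewrite expr_le1 ?normc_ge0.
rewrite z1 !normc_sqr expr1n.
case: z {z1} => a b; case: u {u1} => c d /= U Z.
rewrite -subr_ge0 (_ : _ - _ = (s - r) * ((s - r) * (a ^+ 2 + b ^+ 2) +
  r * ((a ^+ 2 + b ^+ 2) - (c ^+ 2 + d ^+ 2)) +
  r * ((a - c) ^+ 2 + (b - d) ^+ 2))); last by ring.
rewrite -Z; apply: mulr_ge0; first by rewrite subr_ge0.
by do !apply: addr_ge0; apply: mulr_ge0;
  rewrite ?subr_ge0 ?ler01 ?addr_ge0 ?sqr_ge0.
Qed.

Lemma horner_reflect (R : realType) (u z : R[i]) :
  (1 - (conjc u)%:P * 'X).[z] = 1 - conjc u * z.
Proof. by rewrite hornerD hornerN hornerM !hornerC hornerX. Qed.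

Lemma size_reflect (R : realType) (u : R[i]) :
  (size (1 - (conjc u)%:P * 'X : {poly R[i]})%R <= 2)%N.
Proof.
rewrite (leq_trans (size_polyD _ _)) // size_polyN geq_max size_poly1 /=.
rewrite (leq_trans (size_polyMleq _ _)) // size_polyX addn2 /=.
by rewrite size_polyC; case: (_ != _).
Qed.

(** For a zero [w] outside the disk contraction does little harm and the factor
is kept. For [w] inside, write [w = m u] with [m] in [[r, 1]] and [|u| <= 1],
where [m = r] if [|w| <= r] and [|u| = 1] otherwise. The factor of zero [u]
satisfies the first bound: with [m = r] because [rho z] lies outside the disk of
radius [r], and with [|u| = 1] by radial projection. It could fail the second
one, as the circle of radius [r] might meet [u], so its reflection is taken. *)
Lemma factor_minorant (R : realType) (r : R) (w : R[i]) : 0 < r <= 1 ->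
  exists f : {poly R[i]}, [/\ (size f <= 2)%N,
    forall (rho : R) (z : R[i]), r <= rho <= 1 -> normc z = 1 ->
      r * normc f.[z] <= normc (rho%:C%C * z - w) &
    forall z : R[i], normc z = 1 -> r * normc (z - w) <= normc f.[r%:C%C * z]].
Proof.
move=> /andP[r0 r1].
have r0' := ltW r0.
have [w1|/ltW w1] := leP 1 (normc w).
  exists ('X - w%:P); split; first by rewrite size_XsubC.
    move=> rho z /andP[rrho rho1] z1; rewrite hornerXsubC.
    apply: le_trans (ler_wpM2r (normc_ge0 _) rrho) _.
    by apply: normc_sub_shrink; rewrite ?z1 // rho1 (le_trans r0').
  by move=> z z1; rewrite hornerXsubC normc_sub_shrink ?z1 ?r0'.
have [m [u [wE mr u1 um]]] : exists m : R, exists u : R[i],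
    [/\ w = m%:C%C * u, r <= m <= 1, normc u <= 1 & m = r \/ normc u = 1].
  have divK m : 0 < m -> w = m%:C%C * (m%:C%C^-1 * w).
    by move=> m0; rewrite mulrA divff ?mul1r // fmorph_eq0 gt_eqF.
  have normc_div m : 0 < m -> normc (m%:C%C^-1 * w) = normc w / m.
    by move=> m0; rewrite normcM normcV normc_real ?ltW // mulrC.
  have [wr|/ltW rw] := leP (normc w) r.
    exists r, (r%:C%C^-1 * w).
    split; [exact: divK| by rewrite lexx | | by left].
    by rewrite normc_div // ler_pdivrMr // mul1r.
  have m0 : 0 < normc w by apply: lt_le_trans rw.
  have e1 : normc ((normc w)%:C%C^-1 * w) = 1.
    by rewrite normc_div // divff // gt_eqF.
  exists (normc w), ((normc w)%:C%C^-1 * w).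
  by split; [exact: divK| rewrite rw | rewrite e1 | right].
have [rm m1] := andP mr.
exists (1 - (conjc u)%:P * 'X).
split; first exact: size_reflect.
- move=> rho z /andP[rrho _] z1.
  rewrite horner_reflect normc_reflect_circle // wE.
  have [->|u1'] := um; first exact: le_normc_sub_dilate.
  exact: normc_sub_radial.
- move=> z z1; rewrite horner_reflect.
  (* The value at r z is the distance from z to r u, and r u is w contracted
     by r / m. *)
  have -> : conjc u * (r%:C%C * z) = conjc (r%:C%C * u) * z.
    case: (u) => a b; case: (z) => c d.
    by apply/eqP; rewrite eq_complex /=; apply/andP; split; apply/eqP; ring.
  have m0 : 0 < m by apply: lt_le_trans rm.
  have w1' : normc w <= normc z.
    by rewrite z1 wE (normc_scale _ (ltW m0)) mulr_ile1 ?normc_ge0 ?(ltW m0).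
  have t01 : 0 <= r / m <= 1 by rewrite ler_pdivrMr ?mul1r // divr_ge0 // ltW.
  rewrite normc_reflect_circle // normc_subC [leRHS]normc_subC.
  rewrite (_ : r%:C%C * u = (r / m)%:C%C * w).
    apply: le_trans (normc_sub_shrink t01 w1').
    by rewrite ler_wpM2r ?normc_ge0 // ler_pdivlMr // ler_piMr.
  by rewrite wE mulrA -rmorphM divfK // gt_eqF.
Qed.

(** Here the reflection is taken of [w] itself: it increases the modulus inside
the disk, and after it the zero is outside the open disk, so that contracting
[rho z] to [r z] costs at most the factor [r]. *)
Lemma factor_majorant (R : realType) (r : R) (w : R[i]) : 0 < r <= 1 ->
  exists h : {poly R[i]}, [/\ (size h <= 2)%N,
    forall (rho : R) (z : R[i]), r <= rho <= 1 -> normc z = 1 ->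
      r * normc (rho%:C%C * z - w) <= normc h.[r%:C%C * z] &
    forall z : R[i], normc z = 1 -> normc h.[z] <= normc (z - w)].
Proof.
move=> /andP[r0 r1].
have r0' := ltW r0.
have shrink (rho : R) (z v : R[i]) : r <= rho <= 1 ->
    normc (rho%:C%C * z) <= normc v ->
  r * normc (rho%:C%C * z - v) <= normc (r%:C%C * z - v).
  (* r z is the contraction of rho z by r / rho >= r. *)
  move=> /andP[rrho rho1] zv.
  have rho0 : 0 < rho by apply: lt_le_trans rrho.
  have t01 : 0 <= r / rho <= 1 by rewrite ler_pdivrMr ?mul1r // divr_ge0 // ltW.
  rewrite (_ : r%:C%C * z = (r / rho)%:C%C * (rho%:C%C * z)).
    apply: le_trans (normc_sub_shrink t01 zv).
    by rewrite ler_wpM2r ?normc_ge0 // ler_pdivlMr // ler_piMr.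
  by rewrite mulrA -rmorphM divfK // gt_eqF.
have rho_le1 (rho : R) (z : R[i]) : r <= rho <= 1 -> normc z = 1 ->
    normc (rho%:C%C * z) <= 1.
  move=> /andP[rrho rho1] z1.
  by rewrite normc_scale ?z1 ?mulr1 // (le_trans r0').
have [w1|/ltW w1] := leP 1 (normc w).
  exists ('X - w%:P); split; first by rewrite size_XsubC.
    move=> rho z hrho z1; rewrite hornerXsubC; apply: shrink => //.
    exact: le_trans (rho_le1 _ _ hrho z1) w1.
  by move=> z _; rewrite hornerXsubC.
exists (1 - (conjc w)%:P * 'X).
split; first exact: size_reflect.
- move=> rho z hrho z1; rewrite horner_reflect.
  apply: (@le_trans _ _ (r * normc (1 - conjc w * (rho%:C%C * z)))).
    by rewrite ler_pM2l // le_normc_reflect ?rho_le1.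
  rewrite normc_subC [leRHS]normc_subC mulrCA [X in _ <= normc (X - _)]mulrCA.
  apply: shrink => //.
  (* conj w (rho z) is compared with the point 1. *)
  rewrite mulrCA normcM normc1 mulr_ile1 ?normc_ge0 ?rho_le1 //.
  by case: (w) w1 => a b; rewrite /= sqrrN.
- by move=> z z1; rewrite horner_reflect normc_reflect_circle.
Qed.

(** * The norm on the circle *)

(** Continuity is carried along so that means can be added without separate
integrability conditions. *)
Definition has_mean (R : realType) (f : R -> R) (v : R) : Prop :=
  continuous f /\ \int[lebesgue_measure]_(t in `[0%R, 1%R]%classic) f t = v.

Lemma continuous_integrable01 (R : realType) (f : R -> R) : continuous f ->
  (@lebesgue_measure R).-integrable `[0%R, 1%R]%classic (EFin \o f).
Proof.
move=> cf; apply: continuous_compact_integrable; first exact: segment_compact.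
exact: continuous_subspaceT.
Qed.

Lemma has_mean_cst (R : realType) (c : R) : has_mean (fun=> c) c.
Proof.
split; first by move=> x; apply: cvg_cst.
rewrite Rintegral_cst //= lebesgue_measure_itv /= lte_fin ltr01 oppr0 adde0 /=.
by rewrite mulr1.
Qed.

Lemma has_meanD (R : realType) (f g : R -> R) (u v : R) :
  has_mean f u -> has_mean g v -> has_mean (fun t => f t + g t) (u + v).
Proof.
move=> [cf <-] [cg <-]; split.
  by move=> x; apply: cvgD; [apply: cf|apply: cg].
by rewrite RintegralD //; apply: continuous_integrable01.
Qed.

Lemma has_mean_sum (R : realType) (I : Type) (s : seq I)
    (f : I -> R -> R) (v : I -> R) :
  (forall i, has_mean (f i) (v i)) ->
  has_mean (fun t => \sum_(i <- s) f i t) (\sum_(i <- s) v i).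
Proof.
move=> fv; elim: s => [|i s IHs].
  by rewrite big_nil; under eq_fun do rewrite big_nil; apply: has_mean_cst.
by rewrite big_cons; under eq_fun do rewrite big_cons; apply: has_meanD.
Qed.

Lemma is_derive_continuous (R : realType) (F f : R -> R) :
  (forall x : R, is_derive x 1 F (f x)) -> continuous F.
Proof.
move=> dF x; apply/differentiable_continuous/derivable1_diffP.
by have [] := dF x.
Qed.

Lemma has_mean_derive (R : realType) (F f : R -> R) :
  continuous f -> (forall x : R, is_derive x 1 F (f x)) ->
  has_mean f (F 1 - F 0).
Proof.
move=> cf dF; split=> //.
have cF := is_derive_continuous dF.
rewrite /Rintegral (@continuous_FTC2 _ f F) //.
- exact: continuous_subspaceT.
- split; first by move=> x _; have [] := dF x.
  + exact/cvg_at_right_filter/cF.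
  + exact/cvg_at_left_filter/cF.
- by move=> x _; rewrite derive1E; have [] := dF x.
Qed.

Lemma expiM (R : realType) (x y : R) : expi x * expi y = expi (x + y).
Proof.
apply/eqP; rewrite eq_complex /= cosD sinD eqxx /=; apply/eqP; ring.
Qed.

Lemma expiX (R : realType) (x : R) n : expi x ^+ n = expi (x * n%:R).
Proof.
elim: n => [|n IHn]; first by rewrite mulr0 /expi cos0 sin0.
by rewrite exprSr IHn expiM -natr1 mulrDr mulr1.
Qed.

Lemma expiJ (R : realType) (x : R) : conjc (expi x) = expi (- x).
Proof. by rewrite /expi cosN sinN. Qed.

Lemma Re_mul_expi (R : realType) (c : R[i]) (x : R) :
  complex.Re (c * expi x) = complex.Re c * cos x - complex.Im c * sin x.
Proof. by case: c. Qed.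

Lemma expi_2piZ (R : realType) (j k : nat) :
  expi (2 * pi * (j%:R - k%:R)) = 1 :> R[i].
Proof.
have e1 : expi (2 * pi) = 1 :> R[i] by rewrite /expi mulr_natl cos2pi sin2pi.
by rewrite mulrBr -expiM -expiJ -!expiX e1 !expr1n mul1r conjc1.
Qed.

(** Orthogonality of characters: when [expi a = 1] the primitive of
[t |-> expi (a t)] takes the same value at [0] and [1]. *)
Lemma has_mean_Re_expi (R : realType) (c : R[i]) (a : R) : a != 0 ->
  expi a = 1 -> has_mean (fun t => complex.Re (c * expi (a * t))) 0.
Proof.
move=> a0 [cosa sina]; under eq_fun do rewrite Re_mul_expi.
pose F t : R :=
  a^-1 * (complex.Re c * sin (a * t) + complex.Im c * cos (a * t)).
rewrite (_ : 0 = F 1 - F 0); last first.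
  by rewrite /F mulr1 mulr0 cosa sina cos0 sin0 subrr.
have da (x : R) : is_derive x 1 (fun t => a * t) a.
  by apply: is_derive_eq; rewrite /GRing.scale /= mulr1.
have ds (x : R) : is_derive x 1 (fun t => sin (a * t)) (a * cos (a * x)).
  have := is_derive1_comp (is_derive_sin (a * x)) (da x).
  by rewrite mulrC.
have dc (x : R) : is_derive x 1 (fun t => cos (a * t)) (- (a * sin (a * x))).
  have := is_derive1_comp (is_derive_cos (a * x)) (da x).
  by rewrite mulNr mulrC.
apply: has_mean_derive.
  move=> x; apply: cvgB; apply: cvgM; try exact: cvg_cst.
    exact: (is_derive_continuous dc).
  exact: (is_derive_continuous ds).
move=> x; rewrite /F; apply: is_derive_eq.
rewrite /GRing.scale /=.
by field.
Qed.

Lemma normc_sqr_conj (R : realType) (z : R[i]) :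
  normc z ^+ 2 = complex.Re (z * conjc z).
Proof. by rewrite normc_sqr; case: z => a b /=; ring. Qed.

Lemma Re_sum (R : realType) (I : Type) (s : seq I) (f : I -> R[i]) :
  complex.Re (\sum_(i <- s) f i) = \sum_(i <- s) complex.Re (f i).
Proof. exact: raddf_sum. Qed.

(** Expanding [p conj p] gives a double sum of characters, of which only the
diagonal terms have nonzero mean. *)
Lemma has_mean_sqr_normc (R : realType) (n : nat) (p : {poly R[i]}) :
  inPn n p ->
  has_mean (fun t => normc p.[expi (2 * pi * t)] ^+ 2)
    (\sum_(j < n.+1) normc p`_j ^+ 2).
Proof.
move=> sp.
have -> : (fun t => normc p.[expi (2 * pi * t)] ^+ 2) =
  (fun t => \sum_(j < n.+1) \sum_(k < n.+1)
     complex.Re (p`_j * conjc p`_k * expi (2 * pi * (j%:R - k%:R) * t))).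
  apply/funext => t.
  rewrite normc_sqr_conj (horner_coef_wide _ sp) rmorph_sum /=.
  rewrite mulr_suml Re_sum; apply: eq_bigr => j _.
  rewrite mulr_sumr Re_sum; apply: eq_bigr => k _.
  rewrite rmorphM rmorphXn -[X in _ * (_ * X ^+ _)]/(conjc (expi _)).
  rewrite expiJ !expiX mulrACA expiM.
  by congr (complex.Re (_ * expi _)); ring.
have -> : \sum_(j < n.+1) normc p`_j ^+ 2 =
    \sum_(j < n.+1) \sum_(k < n.+1) (if k == j then normc p`_j ^+ 2 else 0).
  apply: eq_bigr => j _; rewrite (bigD1 j) //= eqxx big1 ?addr0 // => k.
  by move=> /negPf ->.
apply: has_mean_sum => j; apply: has_mean_sum => k.
case: eqVneq => [->|kj].
  under eq_fun do rewrite subrr mulr0 mul0r [expi 0]/expi cos0 sin0 mulr1.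
  by rewrite -normc_sqr_conj; apply: has_mean_cst.
apply: has_mean_Re_expi (expi_2piZ _ _ _).
apply: mulf_neq0; last by rewrite subr_eq0 eqr_nat eq_sym.
by rewrite mulf_neq0 ?pnatr_eq0 // gt_eqF ?pi_gt0.
Qed.

Lemma normL2T_sqr (R : realType) (f : R[i] -> R[i]) :
  normL2T f ^+ 2 = \int[lebesgue_measure]_(t in `[0%R, 1%R]%classic)
    (normc (f (expi (2 * pi * t))) ^+ 2).
Proof. by rewrite sqr_sqrtr // Rintegral_ge0 // => t _; apply: sqr_ge0. Qed.

Lemma parseval (R : realType) (n : nat) (p : {poly R[i]}) : inPn n p ->
  normL2T (horner p) ^+ 2 = \sum_(j < n.+1) normc p`_j ^+ 2.
Proof. by move=> sp; rewrite normL2T_sqr; case: (has_mean_sqr_normc sp). Qed.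

Lemma le_normL2T (R : realType) (c : R) (p q : {poly R[i]}) :
  0 <= c ->
  (forall z : R[i], normc z = 1 -> c * normc p.[z] <= normc q.[z]) ->
  c ^+ 2 * normL2T (horner p) ^+ 2 <= normL2T (horner q) ^+ 2.
Proof.
move=> c0 pq; have cont (u : {poly R[i]}) :
    continuous (fun t : R => normc u.[expi (2 * pi * t)] ^+ 2).
  exact: (has_mean_sqr_normc (n := size u) (leqnSn _)).1.
rewrite !normL2T_sqr -RintegralZl //; last exact: continuous_integrable01.
apply: le_Rintegral => //.
- apply: continuous_integrable01 => t; apply: cvgM; first exact: cvg_cst.
  exact: cont.
- exact: continuous_integrable01.
move=> t _; rewrite -exprMn.
by rewrite ler_pXn2r ?nnegrE ?normc_ge0 ?mulr_ge0 ?normc_ge0 // pq ?normc_expi.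
Qed.

(** Contracting the argument multiplies the coefficient of degree [i] by
[r ^+ i], so by Parseval it does not increase the norm. *)
Lemma dilate_poly (R : realType) (n : nat) (r : R) (p : {poly R[i]}) :
  0 <= r <= 1 -> inPn n p ->
  exists q : {poly R[i]}, [/\ inPn n q, forall z, q.[z] = p.[r%:C%C * z] &
    normL2T (horner q) ^+ 2 <= normL2T (horner p) ^+ 2].
Proof.
move=> /andP[r0 r1] sp; pose q := \poly_(i < n.+1) (p`_i * r%:C%C ^+ i).
have sq : inPn n q by apply: size_poly.
exists q; split=> //.
- move=> z; rewrite horner_poly (horner_coef_wide _ sp); apply: eq_bigr => i _.
  by rewrite exprMn mulrA.
rewrite (parseval sp) (parseval sq); apply: ler_sum => i _.
rewrite coef_poly ltn_ord ler_pXn2r ?nnegrE ?normc_ge0 // normcM -rmorphXn.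
by rewrite normc_real ?exprn_ge0 // ler_piMr ?normc_ge0 // exprn_ile1.
Qed.

(** * From factors to polynomials *)

(** Over an algebraically closed field a relation between polynomials that is
compatible with products is realised once it is for the factors ['X - w]. The
index of [Q] bounds the number of factors: the comparisons below lose a factor
[r] for each zero. *)
Lemma factorwise_replacement (F : closedFieldType)
    (Q : nat -> {poly F} -> {poly F} -> Prop) :
  (forall c : F, Q 0 c%:P c%:P) ->
  (forall n p q, Q n p q -> Q n.+1 p q) ->
  (forall n p q w f, Q n p q -> Q 1 ('X - w%:P) f ->
     Q n.+1 (p * ('X - w%:P)) (q * f)) ->
  (forall w : F, exists f : {poly F}, (size f <= 2)%N /\ Q 1 ('X - w%:P) f) ->
  forall n (p : {poly F}), (size p <= n.+1)%N ->
    exists q : {poly F}, (size q <= n.+1)%N /\ Q n p q.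
Proof.
move=> Q0 QS QM Qf; elim=> [|n IHn] p sp.
  by exists p; split=> //; rewrite (size1_polyC sp).
have [sp1|] := leqP (size p) n.+1.
  by have [q [sq Qpq]] := IHn p sp1; exists q; split; [exact: leqW|exact: QS].
move=> np; have spE : size p = n.+2 by apply/eqP; rewrite eqn_leq sp.
have [w /factor_theorem[p' pE]] : exists w, root p w.
  by apply/closed_rootP; rewrite spE.
have sp' : (size p' <= n.+1)%N.
  have p'0 : p' != 0.
    by apply: contraTneq np => p'0; rewrite pE p'0 mul0r size_poly0.
  by move: sp; rewrite pE size_Mmonic ?monicXsubC // size_XsubC addn2.
have [q [sq Qpq]] := IHn p' sp'; have [f [sf Qwf]] := Qf w.
exists (q * f); split; last by rewrite pE; apply: QM.
rewrite (leq_trans (size_polyMleq _ _)) //.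
by rewrite -subn1 leq_subLR (leq_trans (leq_add sq sf)) // addn2.
Qed.

Lemma ler_expM_normcM (R : realType) (r : R) n (a b c d : R[i]) : 0 <= r ->
  r ^+ n * normc a <= normc b -> r * normc c <= normc d ->
  r ^+ n.+1 * normc (a * c) <= normc (b * d).
Proof.
move=> r0 ab cd; rewrite exprSr !normcM mulrACA.
by rewrite ler_pM ?mulr_ge0 ?exprn_ge0 ?normc_ge0.
Qed.

Lemma ler_expS_normc (R : realType) (r : R) n (a b : R[i]) : 0 <= r <= 1 ->
  r ^+ n * normc a <= normc b -> r ^+ n.+1 * normc a <= normc b.
Proof.
move=> /andP[r0 r1]; apply: le_trans; rewrite ler_wpM2r ?normc_ge0 //.
by rewrite exprS ler_piMl ?exprn_ge0.
Qed.

Lemma poly_minorant (R : realType) (r : R) n (p : {poly R[i]}) :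
  0 < r <= 1 -> inPn n p ->
  exists q : {poly R[i]}, [/\ inPn n q,
    forall (rho : R) (z : R[i]), r <= rho <= 1 -> normc z = 1 ->
      r ^+ n * normc q.[z] <= normc p.[rho%:C%C * z] &
    forall z : R[i], normc z = 1 ->
      r ^+ n * normc p.[z] <= normc q.[r%:C%C * z]].
Proof.
move=> r01 sp; have r0 : 0 <= r by case/andP: r01 => /ltW.
have r0' : 0 <= r <= 1 by rewrite r0; case/andP: r01.
pose Q n (p q : {poly R[i]}) :=
  (forall (rho : R) (z : R[i]), r <= rho <= 1 -> normc z = 1 ->
      r ^+ n * normc q.[z] <= normc p.[rho%:C%C * z]) /\
  (forall z : R[i], normc z = 1 ->
      r ^+ n * normc p.[z] <= normc q.[r%:C%C * z]).
suff [q [sq [q1 q2]]] : exists q : {poly R[i]}, (size q <= n.+1)%N /\ Q n p q.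
  by exists q.
apply: (factorwise_replacement (F := R[i]) (Q := Q)) sp.
- by move=> c; split=> *; rewrite !hornerC mul1r.
- move=> m u v [H1 H2]; split=> *; apply: ler_expS_normc => //; auto.
- move=> m u v w f [H1 H2] [H3 H4]; split=> *; rewrite !hornerM.
    by apply: ler_expM_normcM => //; auto.
  by apply: ler_expM_normcM => //; auto.
- move=> w; have [f [sf f1 f2]] := factor_minorant w r01.
  exists f; split=> //; split=> *; rewrite hornerXsubC; auto.
Qed.

Lemma poly_majorant (R : realType) (r : R) n (p : {poly R[i]}) :
  0 < r <= 1 -> inPn n p ->
  exists h : {poly R[i]}, [/\ inPn n h,
    forall (rho : R) (z : R[i]), r <= rho <= 1 -> normc z = 1 ->
      r ^+ n * normc p.[rho%:C%C * z] <= normc h.[r%:C%C * z] &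
    forall z : R[i], normc z = 1 -> normc h.[z] <= normc p.[z]].
Proof.
move=> r01 sp; have r0 : 0 <= r by case/andP: r01 => /ltW.
have r0' : 0 <= r <= 1 by rewrite r0; case/andP: r01.
pose Q n (p h : {poly R[i]}) :=
  (forall (rho : R) (z : R[i]), r <= rho <= 1 -> normc z = 1 ->
      r ^+ n * normc p.[rho%:C%C * z] <= normc h.[r%:C%C * z]) /\
  (forall z : R[i], normc z = 1 -> normc h.[z] <= normc p.[z]).
suff [q [sq [q1 q2]]] : exists q : {poly R[i]}, (size q <= n.+1)%N /\ Q n p q.
  by exists q.
apply: (factorwise_replacement (F := R[i]) (Q := Q)) sp.
- by move=> c; split=> *; rewrite !hornerC ?mul1r.
- by move=> m u v [H1 H2]; split=> *; [apply: ler_expS_normc => //|]; auto.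
- move=> m u v w f [H1 H2] [H3 H4]; split=> *; rewrite !hornerM.
    by apply: ler_expM_normcM => //; auto.
  by rewrite !normcM ler_pM ?normc_ge0; auto.
- move=> w; have [f [sf f1 f2]] := factor_majorant w r01.
  exists f; split=> //; split=> *; rewrite hornerXsubC; auto.
Qed.

(** [q(r .)] has at most the norm of [q] by Parseval, and it dominates
[r^n |p|] on the circle. *)
Lemma sampling_minorant (R : realType) (r : R) n (p : {poly R[i]}) :
  0 < r <= 1 -> inPn n p ->
  exists q : {poly R[i]}, [/\ inPn n q,
    forall (rho : R) (z : R[i]), r <= rho <= 1 -> normc z = 1 ->
      r ^+ n * normc q.[z] <= normc p.[rho%:C%C * z] &
    (r ^+ n) ^+ 2 * normL2T (horner p) ^+ 2 <= normL2T (horner q) ^+ 2].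
Proof.
move=> r01 sp; have [/ltW r0 r1] := andP r01.
have [q [sq q_le le_q]] := poly_minorant r01 sp.
have r01' : 0 <= r <= 1 by rewrite r0.
have [q' [_ q'E q'_le]] := dilate_poly r01' sq.
exists q; split=> //; apply: le_trans q'_le.
by apply: le_normL2T; rewrite ?exprn_ge0 // => z z1; rewrite q'E le_q.
Qed.

(** The majorant is [h(r .)], where [h] is [p] with its inner zeros
reflected. *)
Lemma sampling_majorant (R : realType) (r : R) n (p : {poly R[i]}) :
  0 < r <= 1 -> inPn n p ->
  exists q : {poly R[i]}, [/\ inPn n q,
    forall (rho : R) (z : R[i]), r <= rho <= 1 -> normc z = 1 ->
      r ^+ n * normc p.[rho%:C%C * z] <= normc q.[z] &
    normL2T (horner q) ^+ 2 <= normL2T (horner p) ^+ 2].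
Proof.
move=> r01 sp; have [/ltW r0 r1] := andP r01.
have [h [sh le_h h_le]] := poly_majorant r01 sp.
have r01' : 0 <= r <= 1 by rewrite r0.
have [q [sq qE q_le]] := dilate_poly r01' sh.
exists q; split=> // [rho z hrho z1|]; first by rewrite qE le_h.
apply: le_trans q_le _; rewrite -[leLHS]mul1r -(expr1n _ 2).
by apply: le_normL2T => // z z1; rewrite mul1r h_le.
Qed.

(** * Uniform constants *)

Lemma Re_kern (R : realType) (n : nat) (z : R[i]) :
  complex.Re (kern n z z) = \sum_(j < n.+1) (normc z ^+ 2) ^+ j.
Proof.
rewrite /kern big_mkord Re_sum; apply: eq_bigr => j _.
have -> : z * z^* = (normc z ^+ 2)%:C%C.
  rewrite normc_sqr; case: z => a b.
  by apply/eqP; rewrite eq_complex /=; apply/andP; split; apply/eqP; ring.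
by rewrite -rmorphXn.
Qed.

Lemma kern_bounds (R : realType) (n : nat) (r : R) (z : R[i]) :
  0 <= r -> r <= normc z <= 1 ->
  (r ^+ n) ^+ 2 * n.+1%:R <= complex.Re (kern n z z) <= n.+1%:R.
Proof.
move=> r0 /andP[rz z1]; have z0 := normc_ge0 z.
have sumc (c : R) : \sum_(j < n.+1) c = c * n.+1%:R.
  by rewrite sumr_const card_ord mulr_natr.
rewrite Re_kern -sumc -[n.+1%:R]mul1r -sumc.
apply/andP; split; apply: ler_sum => j _.
  rewrite [leRHS]exprAC ler_pXn2r ?nnegrE ?exprn_ge0 //.
  apply: (@le_trans _ _ (normc z ^+ n)).
    by rewrite lerXn2r ?nnegrE.
  by apply: ler_wiXn2l; rewrite // -ltnS.
by rewrite exprn_ile1 ?exprn_ge0 // exprn_ile1.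
Qed.

(** With [x <= 1/2], [(1 - x) exp (2 x) >= (1 - x) (1 + 2 x) >= 1]. *)
Lemma expR_le_1B (R : realType) (x : R) : 0 <= x <= 2^-1 ->
  expR (- (2 * x)) <= 1 - x.
Proof.
move=> /andP[x0 x1]; rewrite expRN.
have h : 1 <= (1 - x) * (1 + 2 * x) by nra.
rewrite invf_ple ?posrE ?expR_gt0 //; last by lra.
rewrite -[_^-1]mul1r ler_pdivrMr; last by lra.
apply: le_trans h _; rewrite mulrC ler_wpM2r ?expR_ge1Dx //; lra.
Qed.

Lemma expR_le_1B_exp (R : realType) (g : R) (n : nat) :
  0 <= g -> 2 * g <= n%:R -> (0 < n)%N ->
  expR (- (2 * g)) <= (1 - g / n%:R) ^+ n.
Proof.
move=> g0 gn n0; have n0' : 0 < n%:R :> R by rewrite ltr0n.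
have -> : - (2 * g) = n%:R * - (2 * (g / n%:R)) by field; rewrite gt_eqF.
have gx : 0 <= g / n%:R <= 2^-1.
  by rewrite (divr_ge0 g0 (ltW n0')) /= ler_pdivrMr //; lra.
rewrite expRM_natl; apply: lerXn2r; rewrite ?nnegrE ?expR_ge0 //.
  by case/andP: gx; lra.
exact: expR_le_1B.
Qed.

Theorem theorem1p2 (R : realType) (L : nat -> nat)
    (nu : forall n, 'I_(L n) -> R)
    (nu_distinct : forall n, injective (fun k : 'I_(L n) => expi (nu n k)))
    (MZ_nu : MZ_torus nu)
    (gamma : R) (gamma_gt0 : 0 < gamma)
    (rho : forall n, 'I_(L n) -> R)
    (rho_itv : forall n (k : 'I_(L n)), gamma < n%:R ->
       1 - gamma / n%:R <= rho n k /\ rho n k < 1) :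
  MZ_H2 (fun n => [fset (rho n k)%:C%C * expi (nu n k) | k : 'I_(L n)]%fset).
Proof.
have [A [B [A0 B0 [n0 MZ]]]] := MZ_nu.
pose c : R := expR (- (2 * gamma)); have c0 : 0 < c by apply: expR_gt0.
exists (c ^+ 4 * A / 2), (B / c ^+ 4); split.
- by rewrite divr_gt0 // mulr_gt0 ?exprn_gt0.
- by rewrite divr_gt0 ?exprn_gt0.
have [N /ltW NP] : exists N : nat, 2 * gamma < N%:R.
  by exists (Num.bound (2 * gamma)); rewrite archi_boundP // mulr_ge0 // ltW.
exists (maxn n0 N.+1) => n; rewrite geq_max => /andP[n0n Nn] p sp.
have n_gt0 : (0 < n)%N by apply: leq_trans Nn.
have n_gt0' : 0 < n%:R :> R by rewrite ltr0n.
have gn : 2 * gamma <= n%:R by apply: le_trans NP _; rewrite ler_nat ltnW.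
pose r : R := 1 - gamma / n%:R.
have gn' : 0 < gamma / n%:R <= 2^-1.
  by rewrite divr_gt0 //= ler_pdivrMr //; lra.
have r01 : 0 < r <= 1.
  by case/andP: gn' => *; apply/andP; split; rewrite /r; lra.
have [r0 r1] := andP r01.
have crn : c <= r ^+ n by apply: expR_le_1B_exp => //; apply: ltW.
have crn2 : c ^+ 2 <= (r ^+ n) ^+ 2.
  by apply: lerXn2r; rewrite // nnegrE ?exprn_ge0 // ltW.
have hrho k : r <= rho n k <= 1.
  by have [] := rho_itv n k _; [lra | move=> -> /ltW ->].
pose lam k := (rho n k)%:C%C * expi (nu n k).
have lam_norm k : normc (lam k) = rho n k.
  rewrite normc_scale ?normc_expi ?mulr1 //.
  by case/andP: (hrho k) => h _; apply: le_trans h; apply: ltW.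
have lam_inj : injective lam.
  move=> j k jk; apply: (@nu_distinct n).
  have rjk : rho n j = rho n k by rewrite -!lam_norm jk.
  move: jk; rewrite /lam rjk; apply: mulfI.
  rewrite fmorph_eq0 gt_eqF //; case/andP: (hrho k) => h _.
  exact: lt_le_trans h.
rewrite /normH2 big_imfset /=; last by move=> j k _ _; apply: lam_inj.
(* From here on the weight is n, up to the constants c^2 and 2. *)
pose K k := complex.Re (kern n (lam k) (lam k)).
have K_bounds k : c ^+ 2 * n%:R <= K k <= 2 * n%:R.
  have := kern_bounds n (ltW r0) (z := lam k); rewrite lam_norm.
  move=> /(_ (hrho k)) /andP[K1 K2]; apply/andP; split.
    by apply: le_trans K1; apply: ler_pM; rewrite ?sqr_ge0 ?ler_nat.
  by apply: le_trans K2 _; rewrite -natrM ler_nat mul2n -addnn -addn1 leq_add2l.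
have K0 k : 0 < K k.
  case/andP: (K_bounds k) => h _; apply: lt_le_trans h.
  by rewrite mulr_gt0 ?exprn_gt0.
have sumE : \sum_(k <- enum 'I_(L n)) normc p.[lam k] ^+ 2 / K k =
    \sum_(k < L n) normc p.[lam k] ^+ 2 / K k by rewrite big_enum.
rewrite {}sumE.
have c_sqr (x y : R) : 0 <= x -> r ^+ n * x <= y -> c ^+ 2 * x ^+ 2 <= y ^+ 2.
  move=> x0 xy; rewrite -exprMn.
  have cxy : c * x <= y by apply: le_trans xy; rewrite ler_wpM2r.
  have cx0 : 0 <= c * x by rewrite mulr_ge0 // ltW.
  by rewrite ler_pXn2r ?nnegrE // (le_trans cx0).
have c2 : 0 < c ^+ 2 by rewrite exprn_gt0.
split.
- have [q [sq q_le le_q]] := sampling_minorant r01 sp.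
  have [+ _] := MZ n n0n q sq; set T := \sum_(k < L n) _ => AT.
  have ST : c ^+ 2 / 2 * T <= \sum_(k < L n) normc p.[lam k] ^+ 2 / K k.
    rewrite mulr_sumr; apply: ler_sum => k _.
    have [_ Kle] := andP (K_bounds k).
    have qk : c ^+ 2 * normc q.[expi (nu n k)] ^+ 2 <= normc p.[lam k] ^+ 2.
      by apply: c_sqr; rewrite ?normc_ge0 // q_le ?normc_expi.
    rewrite (_ : c ^+ 2 / 2 * _ =
      (c ^+ 2 * normc q.[expi (nu n k)] ^+ 2) / (2 * n%:R)); last first.
      by field; rewrite gt_eqF.
    apply: ler_pM => //; first by rewrite mulr_ge0 ?sqr_ge0 // ltW.
    by rewrite lef_pV2 ?posrE ?mulr_gt0.
  apply: le_trans ST.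
  apply: (@le_trans _ _ (c ^+ 2 / 2 * (A * normL2T (horner q) ^+ 2))).
    rewrite (_ : c ^+ 4 * A / 2 * _ =
      (c ^+ 2 / 2 * A) * (c ^+ 2 * normL2T (horner p) ^+ 2)); last by field.
    rewrite [leRHS]mulrA ler_wpM2l //.
      by rewrite mulr_ge0 ?divr_ge0 // ltW.
    by apply: le_trans le_q; rewrite ler_wpM2r ?sqr_ge0.
  by rewrite ler_wpM2l // divr_ge0 // ltW.
- have [q [sq le_q q_le]] := sampling_majorant r01 sp.
  have [_ +] := MZ n n0n q sq; set T := \sum_(k < L n) _ => TB.
  have ST : \sum_(k < L n) normc p.[lam k] ^+ 2 / K k <= T / c ^+ 4.
    rewrite mulr_suml; apply: ler_sum => k _.
    have [leK _] := andP (K_bounds k).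
    have qk : c ^+ 2 * normc p.[lam k] ^+ 2 <= normc q.[expi (nu n k)] ^+ 2.
      by apply: c_sqr; rewrite ?normc_ge0 // le_q ?normc_expi.
    rewrite (_ : _ / c ^+ 4 =
      (normc q.[expi (nu n k)] ^+ 2 / c ^+ 2) / (c ^+ 2 * n%:R)); last first.
      by field; rewrite !gt_eqF.
    apply: ler_pM; rewrite ?sqr_ge0 ?invr_ge0 ?(ltW (K0 k)) //.
      by rewrite ler_pdivlMr // mulrC.
    by rewrite lef_pV2 ?posrE ?mulr_gt0.
  apply: le_trans ST _.
  rewrite mulrAC ler_wpM2r ?invr_ge0 ?exprn_ge0 ?(ltW c0) //.
  apply: le_trans TB _; rewrite ler_wpM2l //; exact: ltW.
Qed.
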